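(* Let $H\in(0,1)$ and let $u(t)=\sum_{k\ge1}u_k(t)h_k$ be the solution of the diagonalizable equation $du(t)=(\mathcal{A}_0+\theta\mathcal{A}_1)u(t)\,dt+\mathcal{M}u(t)\,dW^H(t)$. For $t>0$ and indices $p,q\in\mathbb{N}$ with $u_p(0)\ne0$, $u_q(0)\ne0$, put $$\alpha_{p,q}=(\nu_p\mu_q-\nu_q\mu_p)t,\qquad \beta_{p,q}=\tfrac12(\mu_q^2\mu_p-\mu_p^2\mu_q),$$ $$\delta_{p,q}=v_p(t)\mu_q-v_q(t)\mu_p-\rho_p\mu_qt+\rho_q\mu_pt,$$ where $v_j(t)=\ln(u_j(t)/u_j(0))$. Let $k,m,i,j\in\mathbb{N}$ (some of which may coincide) be indices with nonzero initial Fourier coefficients such that $\alpha_{k,m}\beta_{i,j}\ne\alpha_{i,j}\beta_{k,m}$. Then the parameter $\theta$ is given exactly by $$\theta=\frac{\delta_{k,m}\beta_{i,j}-\delta_{i,j}\beta_{k,m}}{\alpha_{k,m}\beta_{i,j}-\alpha_{i,j}\beta_{k,m}} .$$ If in addition $\delta_{k,m}\alpha_{i,j}\ne\delta_{i,j}\alpha_{k,m}$ and $t\ne1$, then the Hurst parameter is given exactly by $$H=\frac12\log_t\frac{\delta_{k,m}\alpha_{i,j}-\delta_{i,j}\alpha_{k,m}}{\beta_{k,m}\alpha_{i,j}-\beta_{i,j}\alpha_{k,m}} .$$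
   Context: $W^H$ is a fractional Brownian motion with Hurst parameter $H$: a zero-mean Gaussian process with $\mathbb{E}W^H(t)W^H(s)=\frac12(t^{2H}+s^{2H}-|t-s|^{2H})$. $\mathcal{A}_0,\mathcal{A}_1,\mathcal{M}$ are linear operators in a separable Hilbert space and $\theta$ is a real parameter. The equation is diagonalizable if these operators have point spectrum and a common system of eigenfunctions $\{h_k\}_{k\ge1}$ (a complete orthonormal system); write $\mathcal{A}_0h_k=\rho_kh_k$, $\mathcal{A}_1h_k=\nu_kh_k$, $\mathcal{M}h_k=\mu_kh_k$. By definition, the solution is $u(t)=\sum_{k\ge1}u_k(t)h_k$ with $$u_k(t)=u_k(0)\exp\left((\rho_k+\theta\nu_k)t-\tfrac12\mu_k^2t^{2H}+\mu_kW^H(t)\right),$$ where the $u_k(0)$ are the Fourier coefficients of the deterministic initial condition. $\log_t$ denotes the logarithm to base $t$. *)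

(* Defs.v *)
From HB Require Import structures.
From mathcomp Require Import all_boot all_order all_algebra.
From mathcomp Require Import all_classical all_reals all_analysis.
From mathcomp Require Import ring.
Set Implicit Arguments.
Unset Strict Implicit.
Unset Printing Implicit Defensive.
Import Order.TTheory GRing.Theory Num.Theory.
Import numFieldNormedType.Exports.
Local Open Scope classical_set_scope.
Local Open Scope ring_scope.

Section gaussian_processes.
Context (d : measure_display) (Omega : measurableType d) (R : realType).
Variable P : probability Omega R.

(* Constant variables count as Gaussian. They are treated apart because
   [normal_prob m 0] is not the Dirac mass at [m]. *)
Definition gaussian_variable (X : Omega -> R) : Prop :=
  (exists m s : R, s != 0 /\
     forall A, measurable A -> P (X @^-1` A) = normal_prob m s A) \/
  (exists m : R, \forall w \ae P, X w = m).

(* Processes are indexed by the time half-line: only times [0 <= t] matter. *)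
Definition gaussian_process (X : R -> {RV P >-> R}) : Prop :=
  forall (n : nat) (t a : 'I_n -> R), (forall l, 0 <= t l) ->
    gaussian_variable (fun w => \sum_(l < n) a l * X (t l) w).

Record fractional_brownian_motion (H : R) (W : R -> {RV P >-> R}) : Prop := {
  fbm_gaussian : gaussian_process W;
  fbm_mean : forall t, 0 <= t -> ('E_P[W t] = 0)%E;
  fbm_cov : forall t s, 0 <= t -> 0 <= s ->
    ('E_P[fun w => (W t w * W s w)%R] =
      (2^-1 * (t `^ (2 * H) + s `^ (2 * H) - `|t - s| `^ (2 * H)))%:E)%E }.

End gaussian_processes.

Section hilbert_space.
Context (R : realType) (V : completeNormedModType R).
Variable ip : {dot V for idfun}.

(* With completeness of [V], this makes [V] a real Hilbert space. *)
Definition norm_from_dot : Prop := forall x : V, `|x| ^+ 2 = ip x x.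

Definition separable_space (T : topologicalType) : Prop :=
  exists D : set T, countable D /\ dense D.

Definition orthonormal_seq (h : nat -> V) : Prop :=
  forall k l, ip (h k) (h l) = (k == l)%:R.

Definition linear_span (h : nat -> V) : set V :=
  [set x | exists n (c : 'I_n -> R), x = \sum_(l < n) c l *: h l].

Definition complete_orthonormal (h : nat -> V) : Prop :=
  orthonormal_seq h /\ dense (linear_span h).

End hilbert_space.

(* Linear operator in [V], possibly unbounded: the values of [op_fun] outside
   the subspace [op_dom] are irrelevant. *)
Record operator (R : realType) (V : normedModType R) := Operator {
  op_dom : set V;
  op_fun :> V -> V;
  op_dom0 : op_dom 0;
  op_dom_linear : forall (a : R) x y,
    op_dom x -> op_dom y -> op_dom (a *: x + y);
  op_linear : forall (a : R) x y, op_dom x -> op_dom y ->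
    op_fun (a *: x + y) = a *: op_fun x + op_fun y }.

Definition eigensystem (R : realType) (V : normedModType R) (A : operator V)
    (h : nat -> V) (lambda : nat -> R) : Prop :=
  forall k, op_dom A (h k) /\ A (h k) = lambda k *: h k.

(* The equation du = (A0 + theta A1) u dt + M u dW^H is diagonalizable, with
   common eigenfunctions [h k] and eigenvalues [rho k], [nu k], [mu k]. *)
Definition diagonalizable_equation (R : realType) (V : completeNormedModType R)
    (ip : {dot V for idfun}) (A0 A1 M : operator V)
    (h : nat -> V) (rho nu mu : nat -> R) : Prop :=
  [/\ complete_orthonormal ip h,
      eigensystem A0 h rho, eigensystem A1 h nu & eigensystem M h mu].

(* The series sum_k c_k h_k, given by its coefficients. No convergence in [V]
   is required, as the solution of the equation is defined by its Fourier
   series alone; when the series converges in [V], the [c_k] are the Fourier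
   coefficients of its sum (lemma [coef_fsum_to]). *)
Record fourier_series (R : realType) (V : normedModType R) (h : nat -> V) :=
  FourierSeries { coef : nat -> R }.

Definition fsum_to (R : realType) (V : normedModType R) (h : nat -> V)
    (c : fourier_series h) (x : V) : Prop :=
  series (fun k => coef c k *: h k) @ \oo --> x.

Lemma coef_fsum_to (R : realType) (V : completeNormedModType R)
    (ip : {dot V for idfun}) (h : nat -> V) (c : fourier_series h) (x : V) :
  norm_from_dot ip -> orthonormal_seq ip h -> fsum_to c x ->
  forall k, coef c k = ip x (h k).
Proof.
move=> nrm orth cx k.
have nh : ip (h k) (h k) = 1 by rewrite orth eqxx.
have ipC a b : ip a b = ip b a.
  by have /= := hermC ip a b; rewrite expr0 mul1r.
have cs y : `|ip y (h k)| <= `|y|.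
  rewrite -(@ler_pXn2r _ 2) ?nnegrE// real_normK ?num_real// nrm.
  rewrite -subr_ge0.
  have -> : ip y y - ip y (h k) ^+ 2 =
      ip (y - ip y (h k) *: h k) (y - ip y (h k) *: h k).
    rewrite !linearBl !linearBr !linearZl_LR !linearZr/= nh (ipC (h k) y).
    by rewrite /GRing.scale/=; ring.
  by rewrite -nrm sqr_ge0.
apply/eqP; rewrite -subr_eq0 -normr_eq0 eq_le normr_ge0 andbT.
apply/ler_addgt0Pl => e e0; rewrite addr0.
have /cvgrPdist_le /(_ e e0) [n _ /(_ (maxn n k.+1))] := cx.
rewrite /= leq_maxl => /(_ isT) /(le_trans _); apply.
rewrite distrC.
suff -> : coef c k = ip (series (fun k => coef c k *: h k) (maxn n k.+1)) (h k).
  by rewrite -linearBl; exact: cs.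
rewrite seriesEord ipC linear_sumr/=.
rewrite (bigD1 (Ordinal (leq_maxr n k.+1)))//= linearZr/= nh mulr1.
rewrite big1 ?addr0// => i ik; rewrite linearZr/= orth eq_sym.
by rewrite -(inj_eq val_inj)/= in ik; rewrite (negbTE ik) mulr0.
Qed.

(* The clause at [t = 0] is separate because [W 0 = 0] only almost surely. *)
Definition is_solution (d : measure_display) (Omega : measurableType d)
    (R : realType) (P : probability Omega R) (V : normedModType R)
    (h : nat -> V) (rho nu mu : nat -> R) (theta H : R)
    (W : R -> {RV P >-> R}) (u0 : fourier_series h)
    (u : R -> Omega -> fourier_series h) : Prop :=
  (forall w, u 0 w = u0) /\
  (forall t w k, 0 < t ->
    coef (u t w) k = coef u0 k *
      expR ((rho k + theta * nu k) * t
            - 2^-1 * mu k ^+ 2 * t `^ (2 * H) + mu k * W t w)).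

Section estimators.
Context (R : realType).
Implicit Types (rho nu mu v : nat -> R) (t : R) (p q : nat).

Definition alpha nu mu t p q : R := (nu p * mu q - nu q * mu p) * t.

Definition beta mu p q : R := 2^-1 * (mu q ^+ 2 * mu p - mu p ^+ 2 * mu q).

Definition delta rho mu v t p q : R :=
  v p * mu q - v q * mu p - rho p * mu q * t + rho q * mu p * t.

Definition log_ratio (Omega : Type) (V : normedModType R) (h : nat -> V)
    (u : R -> Omega -> fourier_series h) t (w : Omega) (l : nat) : R :=
  ln (coef (u t w) l / coef (u 0 w) l).

Definition logb (b x : R) : R := ln x / ln b.

End estimators.

(* Main.v *)
Require Import Defs.
From mathcomp Require Import all_boot all_order all_algebra.
From mathcomp Require Import all_classical all_reals all_analysis.
From mathcomp Require Import ring.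
Set Implicit Arguments.
Unset Strict Implicit.
Unset Printing Implicit Defensive.
Import Order.TTheory GRing.Theory Num.Theory.
Import numFieldNormedType.Exports.
Local Open Scope classical_set_scope.
Local Open Scope ring_scope.

(** Each mode gives one equation in the unknowns [theta], [t `^ (2 * H)] and
[W t w]: the logarithm of [coef (u t w) l / coef u0 l] is affine in all three.
The noise is the same for all modes, so weighting mode [p] by [mu q], mode [q]
by [mu p] and subtracting eliminates it ([delta_affine]):
[delta p q = theta * alpha p q + t `^ (2 * H) * beta p q].
Two pairs of modes thus give a 2 x 2 linear system in [theta] and
[t `^ (2 * H)], with invertible matrix by hypothesis, and Cramer's rule yields
both unknowns; a logarithm to base [t] recovers [H] from the second. *)

(** The equation for the second unknown divides by the opposite of the
determinant, which is the form taken by the Hurst estimator. *)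
Lemma cramer2 (F : fieldType) (a1 b1 d1 a2 b2 d2 x y : F) :
  a1 * b2 != a2 * b1 ->
  d1 = x * a1 + y * b1 -> d2 = x * a2 + y * b2 ->
  x = (d1 * b2 - d2 * b1) / (a1 * b2 - a2 * b1) /\
  y = (d1 * a2 - d2 * a1) / (b1 * a2 - b2 * a1).
Proof.
rewrite -subr_eq0 => det0 -> ->.
have det0' : b1 * a2 - b2 * a1 != 0.
  by rewrite -oppr_eq0 opprB mulrC (mulrC b1).
by split; field.
Qed.

Lemma logb_powR (R : realType) (t x : R) : 0 < t -> t != 1 ->
  logb t (t `^ x) = x.
Proof.
by move=> t0 t1; rewrite /logb ln_powR mulfK// ln_eq0.
Qed.

Lemma log_ratio_solution (d : measure_display) (Omega : measurableType d)
    (R : realType) (P : probability Omega R) (V : normedModType R)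
    (h : nat -> V) (rho nu mu : nat -> R) (theta H : R)
    (W : R -> {RV P >-> R}) (u0 : fourier_series h)
    (u : R -> Omega -> fourier_series h) (t : R) (w : Omega) (l : nat) :
  is_solution rho nu mu theta H W u0 u -> 0 < t -> coef u0 l != 0 ->
  log_ratio u t w l = (rho l + theta * nu l) * t
    - 2^-1 * mu l ^+ 2 * t `^ (2 * H) + mu l * W t w.
Proof.
move=> [u_init u_pos] t0 u0l.
by rewrite /log_ratio u_init u_pos// mulrAC divff// mul1r expRK.
Qed.

(** The weights [mu q] and [mu p] make the two noise terms
[mu p * mu q * x] cancel; here [y] stands for [t `^ (2 * H)] and [x] for the
value of the noise. *)
Lemma delta_affine (R : realType) (rho nu mu v : nat -> R) (theta t x y : R)
    (p q : nat) :
  (forall l, l \in [:: p; q] -> v l =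
    (rho l + theta * nu l) * t - 2^-1 * mu l ^+ 2 * y + mu l * x) ->
  delta rho mu v t p q = theta * alpha nu mu t p q + y * beta mu p q.
Proof.
move=> vE; rewrite /delta /alpha /beta !vE ?inE ?eqxx ?orbT//; ring.
Qed.

Theorem mainTheorem6 (R : realType)
    (d : measure_display) (Omega : measurableType d) (P : probability Omega R)
    (H : R) (H01 : 0 < H < 1)
    (W : R -> {RV P >-> R}) (W_fbm : fractional_brownian_motion H W)
    (V : completeNormedModType R) (ip : {dot V for idfun})
    (V_hilbert : norm_from_dot ip) (V_separable : separable_space V)
    (A0 A1 M : operator V) (theta : R)
    (h : nat -> V) (rho nu mu : nat -> R)
    (diag : diagonalizable_equation ip A0 A1 M h rho nu mu)
    (u0 : fourier_series h) (u : R -> Omega -> fourier_series h)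
    (u_sol : is_solution rho nu mu theta H W u0 u)
    (t : R) (t_gt0 : 0 < t) (k m i j : nat)
    (u0k : coef u0 k != 0) (u0m : coef u0 m != 0)
    (u0i : coef u0 i != 0) (u0j : coef u0 j != 0)
    (w : Omega) :
  let al := alpha nu mu t in
  let be := beta mu in
  let de := delta rho mu (log_ratio u t w) t in
  al k m * be i j != al i j * be k m ->
  theta = (de k m * be i j - de i j * be k m) /
          (al k m * be i j - al i j * be k m) /\
  (de k m * al i j != de i j * al k m -> t != 1 ->
   H = 2^-1 * logb t ((de k m * al i j - de i j * al k m) /
                      (be k m * al i j - be i j * al k m))).
Proof.
move=> al be de det0.
have deE p q : coef u0 p != 0 -> coef u0 q != 0 ->
    de p q = theta * al p q + t `^ (2 * H) * be p q.
  move=> u0p u0q; apply: (delta_affine (x := W t w)) => l.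
  rewrite !inE => /orP[] /eqP ->.
    exact: (log_ratio_solution w u_sol t_gt0 u0p).
  exact: (log_ratio_solution w u_sol t_gt0 u0q).
have [thetaE powE] := cramer2 det0 (deE _ _ u0k u0m) (deE _ _ u0i u0j).
by split=> // _ t1; rewrite -powE logb_powR// mulKf.
Qed.
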